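(* Let $1<p<\infty$, let $r,s$ be (real or complex) numbers, and let $U(s,r,s)$ be the bounded linear operator on $\ell_p$ defined by the symmetric tri-band matrix with $r$ on the main diagonal and $s$ on the first super- and sub-diagonals. Then the continuous spectrum of $U(s,r,s)$ on $\ell_p$ is $$\sigma_c\left(U(s,r,s),\ell_p\right)=[r-2s,\,r+2s].$$
   Context: $[r-2s,r+2s]=\{r+2s\cos\theta:\theta\in[0,2\pi]\}$ is the line segment in $\mathbb{C}$ joining $r-2s$ and $r+2s$. $\mathbb{N}=\{0,1,2,\dots\}$. $\ell_p$ is the complex Banach space of sequences $x=(x_k)_{k\in\mathbb{N}}$ with $\sum_k|x_k|^p<\infty$, with its usual norm. The operator $U(s,r,s)$ acts by $(U(s,r,s)x)_k=sx_{k-1}+rx_k+sx_{k+1}$ for $k\in\mathbb{N}$, with the convention $x_{-1}=0$. For a bounded linear operator $T$ on a complex Banach space $X$, the continuous spectrum $\sigma_c(T,X)$ is the set of all $\lambda\in\mathbb{C}$ such that $T-\lambda I$ is injective and has dense range in $X$, but the inverse $(T-\lambda I)^{-1}$, defined on that range, is not bounded.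
   Formalization: The formal theorem assumes s ≠ 0; for s = 0 the claim is false, since U(s,r,s) = rI has empty continuous spectrum while [r-2s, r+2s] = {r}. *)

(* Defs.v *)
From HB Require Import structures.
From mathcomp Require Import all_boot all_order all_algebra.
From mathcomp Require Import complex.
From mathcomp Require Import all_classical all_reals all_analysis.
From mathcomp Require Import ring.

Set Implicit Arguments.
Unset Strict Implicit.
Unset Printing Implicit Defensive.

Import Order.TTheory GRing.Theory Num.Theory.
Import numFieldNormedType.Exports.
Import ComplexField.Normc.

Local Open Scope classical_set_scope.
Local Open Scope complex_scope.
Local Open Scope ring_scope.

(* Codomain [R[i]^o]: sequences form a module over [R[i]] pointwise. *)
Section lp_norm.
Context {R : realType}.
Implicit Types (p : R) (x y : nat -> R[i]^o).

Definition lp_sum p x : \bar R := (\sum_(k <oo) (normc (x k) `^ p)%:E)%E.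

Definition lp_norm p x : R := fine (lp_sum p x) `^ p^-1.

Arguments lp_sum p%_R x%_R.

Lemma normc_ge0 (z : R[i]) : 0 <= normc z.
Proof. by case: z => a b; exact: sqrtr_ge0. Qed.

Lemma lp_sum_ge0 p x : (0 <= lp_sum p x)%E.
Proof. by apply: nneseries_ge0 => k _ _; rewrite lee_fin powR_ge0. Qed.

Lemma lp_norm_ge0 p x : 0 <= lp_norm p x.
Proof. exact: powR_ge0. Qed.

Lemma lp_sum_poweRV p x : 0 < p ->
  (lp_sum p x `^ p^-1)%E = 'N[counting]_p%:E[EFin \o (fun k => normc (x k))]%E.
Proof.
move=> p0; rewrite Lnorm_counting//; congr (poweR _ _).
by apply: eq_eseriesr => k _ /=; rewrite ger0_norm ?normc_ge0.
Qed.

Lemma lp_normE p x : (lp_sum p x < +oo)%E ->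
  (lp_norm p x)%:E = (lp_sum p x `^ p^-1)%E.
Proof.
by move=> xp; rewrite /lp_norm -poweR_EFin fineK// ge0_fin_numE// lp_sum_ge0.
Qed.

Lemma lp_sum_minkowski p x y : 1 <= p ->
  (lp_sum p (x + y) `^ p^-1 <= lp_sum p x `^ p^-1 + lp_sum p y `^ p^-1)%E.
Proof.
move=> p1; have p0 : 0 < p by exact: lt_le_trans p1.
have mN (z : nat -> R[i]^o) :
  measurable_fun [set: nat] (fun k => normc (z k)) by [].
rewrite !lp_sum_poweRV//.
apply: le_trans (minkowski_EFin counting (mN x) (mN y) p1).
rewrite !Lnorm_counting//.
apply: gt0_ler_poweR; rewrite ?invr_ge0 ?(ltW p0)//.
- rewrite in_itv/= leey andbT.
  by apply: nneseries_ge0 => k _ _; rewrite lee_fin powR_ge0.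
- rewrite in_itv/= leey andbT.
  by apply: nneseries_ge0 => k _ _; rewrite lee_fin powR_ge0.
apply: lee_nneseries => [k _ _|k _]; first by rewrite lee_fin powR_ge0.
rewrite /= lee_fin !ger0_norm ?addr_ge0 ?normc_ge0//.
by rewrite ge0_ler_powR ?nnegrE ?addr_ge0 ?normc_ge0 ?(ltW p0) ?le_normcD.
Qed.

Lemma lp_sumZ p a x : lp_sum p (a *: x) = ((normc a `^ p)%:E * lp_sum p x)%E.
Proof.
rewrite -nneseriesZl; last by move=> k _; rewrite lee_fin powR_ge0.
apply: eq_eseriesr => k _.
by rewrite -EFinM -powRM ?normc_ge0// -normcM.
Qed.

Lemma lp_sum_ltyD p x y : 1 <= p -> (lp_sum p x < +oo)%E ->
  (lp_sum p y < +oo)%E -> (lp_sum p (x + y) < +oo)%E.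
Proof.
move=> p1 xp yp; apply: (@lty_poweRy _ _ p^-1).
  by rewrite gt_eqF// invr_gt0 (lt_le_trans _ p1).
apply: le_lt_trans (lp_sum_minkowski _ _ p1) _.
by rewrite lte_add_pinfty// poweR_lty.
Qed.

Lemma ler_lp_normD p x y : 1 <= p -> (lp_sum p x < +oo)%E ->
  (lp_sum p y < +oo)%E -> lp_norm p (x + y) <= lp_norm p x + lp_norm p y.
Proof.
move=> p1 xp yp; have xyp := lp_sum_ltyD p1 xp yp.
have := lp_sum_minkowski x y p1.
by rewrite -(lp_normE xp) -(lp_normE yp) -(lp_normE xyp) lee_fin.
Qed.

Lemma lp_sum0 p : 0 < p -> lp_sum p 0 = 0%E.
Proof.
by move=> p0; apply: eseries0 => k _ _; rewrite normc0 powR0// gt_eqF.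
Qed.

Lemma lp_sum_ge p x k : ((normc (x k) `^ p)%:E <= lp_sum p x)%E.
Proof.
have x0 j : xpredT j -> (0 <= (normc (x j) `^ p)%:E)%E.
  by rewrite lee_fin powR_ge0.
rewrite /lp_sum (nneseriesD1 x0 (n := k))/=; last by [].
apply: leeDl; apply: nneseries_ge0 => j _ _; exact: x0.
Qed.

Lemma lp_sum_powR p x : 0 < p -> (lp_sum p x < +oo)%E ->
  lp_sum p x = (lp_norm p x `^ p)%:E.
Proof.
move=> p0 xp; rewrite /lp_norm -powRrM mulVf ?gt_eqF// powRr1.
  by rewrite fineK// ge0_fin_numE// lp_sum_ge0.
exact/fine_ge0/lp_sum_ge0.
Qed.

Lemma lp_sum_le p x e : 0 < p -> (lp_sum p x < +oo)%E ->
  lp_norm p x <= e -> (lp_sum p x <= (e `^ p)%:E)%E.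
Proof.
move=> p0 xp xe; rewrite (lp_sum_powR p0 xp) lee_fin.
by rewrite ge0_ler_powR ?(ltW p0) ?nnegrE ?(le_trans _ xe) ?lp_norm_ge0.
Qed.

Lemma lp_norm_le p x e : 0 < p -> 0 <= e ->
  (lp_sum p x <= (e `^ p)%:E)%E -> lp_norm p x <= e.
Proof.
move=> p0 e0 xe; have xp := le_lt_trans xe (ltry _).
rewrite leNgt; apply/negP => ex; move: xe; apply/negP; rewrite -ltNge.
rewrite (lp_sum_powR p0 xp) lte_fin.
by rewrite gt0_ltr_powR ?nnegrE ?(le_trans e0 (ltW ex)).
Qed.

Definition lp_trunc (N : nat) x : nat -> R[i]^o :=
  fun k => if (k < N)%N then x k else 0.

Lemma lp_sum_trunc p N x : 0 < p ->
  lp_sum p (lp_trunc N x) = (\sum_(k < N) normc (x k) `^ p)%:E.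
Proof.
move=> p0; rewrite /lp_sum.
have t0 k : (0 <= (normc (lp_trunc N x k) `^ p)%:E)%E by rewrite lee_fin powR_ge0.
rewrite (nneseries_split 0 N)//= add0n [X in (_ + X)%E]eseries0 ?adde0; last first.
  move=> k Nk _; rewrite /lp_trunc ifN -?leqNgt// normc0.
  by rewrite powR0// gt_eqF.
rewrite big_mkord sumEFin; congr (_%:E).
by apply: eq_bigr => k _; rewrite /lp_trunc ltn_ord.
Qed.

Lemma lp_sum_sup p x M :
  (forall N, (\sum_(k < N) normc (x k) `^ p <= M)%R) -> (lp_sum p x <= M%:E)%E.
Proof.
move=> xM; apply: lime_le.
  by apply: is_cvg_nneseries => k _ _; rewrite lee_fin powR_ge0.
by apply: nearW => N; rewrite big_mkord sumEFin lee_fin.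
Qed.

Lemma lp_sum_part p N x : ((\sum_(k < N) normc (x k) `^ p)%:E <= lp_sum p x)%E.
Proof.
have x0 k : (0 <= N)%N -> true -> (0 <= (normc (x k) `^ p)%:E)%E.
  by rewrite lee_fin powR_ge0.
rewrite -sumEFin -(big_mkord xpredT (fun k => (normc (x k) `^ p)%:E)).
apply: nneseries_lim_ge => k _ _; by rewrite lee_fin powR_ge0.
Qed.

Lemma lp_sum_shiftl p x : (lp_sum p (fun k => x k.+1) <= lp_sum p x)%E.
Proof.
have x0 k : (0 <= (normc (x k) `^ p)%:E)%E by rewrite lee_fin powR_ge0.
rewrite /lp_sum [leRHS]nneseries_recl// -(nneseries_addn _ x0).
under [in leRHS]eq_eseriesr do rewrite addn1.
exact: leeDr.
Qed.

Lemma lp_sum_shiftr p x : 0 < p ->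
  lp_sum p (fun k => if k is j.+1 then x j else 0) = lp_sum p x.
Proof.
move=> p0; rewrite /lp_sum nneseries_recl//; last first.
  by move=> k _; rewrite lee_fin powR_ge0.
rewrite -nneseries_addn; last by move=> k; rewrite lee_fin powR_ge0.
rewrite normc0 powR0 ?gt_eqF// add0e.
by apply: eq_eseriesr => k _; rewrite addn1.
Qed.

End lp_norm.
Arguments lp_sum {R} p%_R x%_R.
Arguments lp_norm {R} p%_R x%_R.
Arguments lp_trunc {R} N%_N x%_R.

Section lp_space.
Context {R : realType}.

Definition lp_pred (p : R) (p1 : 1 <= p) : {pred nat -> R[i]^o} :=
  [pred x | (lp_sum p x < +oo)%E].

(* As for [LfunType], the proof of [1 <= p] is a parameter of the type, so that
   Minkowski's inequality is available to the structure instances. *)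
Record lp (p : R) (p1 : 1 <= p) := Lp {
  lp_val :> nat -> R[i]^o ;
  lp_valP : lp_val \in lp_pred p1 }.

Variables (p : R) (p1 : 1 <= p).

HB.instance Definition _ := [isSub for @lp_val p p1].
HB.instance Definition _ := [Choice of lp p1 by <:].

Let p_gt0 : 0 < p. Proof. exact: lt_le_trans p1. Qed.

Lemma lp_submod_closed : submod_closed (lp_pred p1).
Proof.
split; first by rewrite inE lp_sum0.
move=> a x y; rewrite !inE => xp yp.
apply: (lp_sum_ltyD p1 _ yp); rewrite lp_sumZ.
by apply: lte_mul_pinfty xp => //; rewrite lee_fin powR_ge0.
Qed.

HB.instance Definition _ := GRing.isSubmodClosed.Build _ _ (lp_pred p1)
  lp_submod_closed.
HB.instance Definition _ := [SubChoice_isSubLmodule of lp p1 by <:].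

Implicit Types x y : lp p1.

Lemma lp_sum_lty x : (lp_sum p x < +oo)%E.
Proof. by have := lp_valP x; rewrite inE. Qed.

(* The norm of a [normedModType R[i]] takes its values in [R[i]]. *)
Let nm x : R[i] := (lp_norm p x)%:C.

Let ler_nmD x y : nm (x + y) <= nm x + nm y.
Proof.
have nmD := ler_lp_normD p1 (lp_sum_lty x) (lp_sum_lty y).
by rewrite lecE/= addr0 eqxx.
Qed.

Let nmZ a x : nm (a *: x) = `|a| * nm x.
Proof.
rewrite /nm [`|a|]normc_def.
rewrite (_ : Num.sqrt _ = normc a); last by case: a.
rewrite -rmorphM; congr (_%:C).
rewrite /lp_norm (_ : lp_val (a *: x) = a *: lp_val x)// lp_sumZ.
rewrite fineM//; last first.
  by rewrite ge0_fin_numE ?lp_sum_lty// lp_sum_ge0.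
rewrite powRM ?powR_ge0 ?fine_ge0 ?lp_sum_ge0//.
by rewrite -powRrM divff ?gt_eqF// powRr1 ?normc_ge0.
Qed.

Let nm0_eq0 x : nm x = 0 -> x = 0.
Proof.
move=> /(congr1 (@complex.Re R))/=/powR_eq0_eq0 x0.
apply/val_inj/funext => k; apply/eq0_normc/(@powR_eq0_eq0 _ _ p)/eqP.
rewrite eq_le powR_ge0 andbT -lee_fin (le_trans (lp_sum_ge p x k))//.
rewrite -[leLHS]fineK ?x0//.
by rewrite ge0_fin_numE ?lp_sum_lty// lp_sum_ge0.
Qed.

HB.instance Definition _ := @Lmodule_isNormed.Build R[i] (lp p1)
  nm ler_nmD nmZ nm0_eq0.

Lemma lp_normrE x : `|x| = (lp_norm p x)%:C.
Proof. by []. Qed.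

End lp_space.

Section lp_complete.
Context {R : realType} (p : R) (p1 : 1 <= p).

Let p_gt0 : 0 < p. Proof. exact: lt_le_trans p1. Qed.

Lemma normc_le_ReIm (z : R[i]) : normc z <= `|complex.Re z| + `|complex.Im z|.
Proof.
case: z => a b /=; rewrite -[leRHS]ger0_norm ?addr_ge0// -sqrtr_sqr.
rewrite ler_wsqrtr// sqrrD !real_normK ?num_real//.
by rewrite -addrA [X in _ <= _ + X]addrC lerD2l lerDl mulrn_wge0// mulr_ge0.
Qed.

Lemma normcRe_le (z : R[i]) : `|complex.Re z| <= normc z.
Proof.
by case: z => a b /=; rewrite -sqrtr_sqr ler_wsqrtr// lerDl sqr_ge0.
Qed.

Lemma normcIm_le (z : R[i]) : `|complex.Im z| <= normc z.
Proof.
by case: z => a b /=; rewrite -sqrtr_sqr ler_wsqrtr// lerDr sqr_ge0.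
Qed.

Lemma normc_le_lp_norm (x : nat -> R[i]^o) k : (lp_sum p x < +oo)%E ->
  normc (x k) <= lp_norm p x.
Proof.
move=> xp; rewrite -(powRr1 (normc_ge0 (x k))) -(powRr1 (lp_norm_ge0 p x)).
rewrite -(divff (lt0r_neq0 p_gt0)) !powRrM ge0_ler_powR ?invr_ge0 ?(ltW p_gt0)
  ?nnegrE ?powR_ge0//.
rewrite -lee_fin -(lp_sum_powR p_gt0 xp); exact: lp_sum_ge.
Qed.

Lemma lp_norm_trunc_le (N : nat) (x : nat -> R[i]^o) (e : R) : 0 <= e ->
  (forall k, (k < N)%N -> normc (x k) <= e / N.+1%:R) ->
  lp_norm p (lp_trunc N x) <= e.
Proof.
move=> e0 xe; apply: (lp_norm_le p_gt0 e0).
rewrite (lp_sum_trunc _ _ p_gt0) lee_fin.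
have N0 : 0 <= e / N.+1%:R by rewrite divr_ge0.
apply: (@le_trans _ _ (\sum_(k < N) (e / N.+1%:R) `^ p)).
  apply: ler_sum => k _.
  by rewrite ge0_ler_powR ?(ltW p_gt0) ?nnegrE ?normc_ge0// xe.
rewrite sumr_const card_ord powRM ?invr_ge0// -mulrnAr ler_piMr ?powR_ge0//.
have NV : 0 < (N.+1%:R : R)^-1 <= 1.
  by rewrite invr_gt0 ltr0Sn invf_le1 ?ltr0Sn// ler1n.
apply: (@le_trans _ _ (N.+1%:R^-1 *+ N)); first by rewrite lerMn2r ge1r_powR ?orbT.
by rewrite -[leLHS]mulr_natl ler_pdivrMr ?ltr0Sn// mul1r ler_nat.
Qed.

Lemma lp_complete (F : set_system (lp p1)) : ProperFilter F -> cauchy F -> cvg F.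
Proof.
move=> FF /cauchyP Fc.
have {}Fc (e : R) : 0 < e ->
    exists x : lp p1, \forall y \near F, lp_norm p (lp_val x - lp_val y) < e.
  move=> e0; have e0C : 0 < e%:C :> R[i] by rewrite ltcR.
  have [x Fx] := Fc _ e0C; exists x; apply: filterS Fx => y.
  rewrite -ball_normE /ball_/= lp_normrE ltcR; exact.
have coord (h : R[i] -> R) k :
    (forall z t, h (z - t) = h z - h t) -> (forall z, `|h z| <= normc z) ->
    cvg ((fun x : lp p1 => h (x k)) @ F).
  move=> hB hn; apply: cauchy_cvg; apply/cauchyP => e e0.
  have [x Fx] := Fc _ e0; exists (h (x k)).
  apply: filterS Fx => y xy; rewrite -ball_normE /ball_/= -hB.
  apply: le_lt_trans (hn _) _; apply: le_lt_trans xy.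
  exact: (normc_le_lp_norm k (lp_sum_lty (x - y))).
have ReB (u v : R[i]) : complex.Re (u - v) = complex.Re u - complex.Re v.
  by case: u v => [? ?] [? ?].
have ImB (u v : R[i]) : complex.Im (u - v) = complex.Im u - complex.Im v.
  by case: u v => [? ?] [? ?].
have cRe k : cvg ((fun x : lp p1 => complex.Re (x k)) @ F).
  exact: coord ReB normcRe_le.
have cIm k : cvg ((fun x : lp p1 => complex.Im (x k)) @ F).
  exact: coord ImB normcIm_le.
pose z : nat -> R[i]^o := fun k =>
  lim ((fun x : lp p1 => complex.Re (x k)) @ F) +i*
  lim ((fun x : lp p1 => complex.Im (x k)) @ F).
have near_z k (d : R) : 0 < d ->
    \forall y \near F, normc ((lp_val y - z) k) <= d.
  move=> d0; have d20 : 0 < d / 2 by rewrite divr_gt0.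
  have /cvgrPdistC_le/(_ _ d20) H1 := cRe k.
  have /cvgrPdistC_le/(_ _ d20) H2 := cIm k.
  near=> y; apply: le_trans (normc_le_ReIm _) _.
  rewrite [leRHS](splitr d); apply: lerD.
    by near: y; apply: filterS H1 => y; rewrite -(ReB _ (z k)).
  by near: y; apply: filterS H2 => y; rewrite -(ImB _ (z k)).
have close (e : R) (x : lp p1) : 0 < e ->
    (\forall y \near F, lp_norm p (lp_val x - lp_val y) < e) ->
    (lp_sum p (lp_val x - z) <= ((e + e) `^ p)%:E)%E.
  move=> e0 Fx; apply: lp_sum_sup => N.
  have : \forall y \near F, forall k : 'I_N,
      normc ((lp_val y - z) k) <= e / N.+1%:R.
    have := @filter_forall _ 'I_N
      (fun k => [set y : lp p1 | normc ((lp_val y - z) k) <= e / N.+1%:R])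
      F (@filter_filter _ _ FF).
    move=> /(_ (fun k => near_z k _ (divr_gt0 e0 (ltr0Sn _ _)))).
    by apply: filterS => y + k; apply.
  move=> Fz; have [y [xy yz]] := filter_ex (filterI Fx Fz).
  rewrite -lee_fin -(lp_sum_trunc _ _ p_gt0).
  have xyp := lp_sum_lty (x - y).
  have t1p : (lp_sum p (lp_trunc N (lp_val x - lp_val y)) < +oo)%E.
    by rewrite (lp_sum_trunc _ _ p_gt0) ltry.
  have t2p : (lp_sum p (lp_trunc N (lp_val y - z)) < +oo)%E.
    by rewrite (lp_sum_trunc _ _ p_gt0) ltry.
  have -> : lp_trunc N (lp_val x - z) =
      lp_trunc N (lp_val x - lp_val y) + lp_trunc N (lp_val y - z).
    apply/funext => k; rewrite /lp_trunc !fctE.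
    by case: ifPn => _; rewrite ?addr0// addrA subrK.
  apply: (lp_sum_le p_gt0 (lp_sum_ltyD p1 t1p t2p)).
  apply: le_trans (ler_lp_normD p1 t1p t2p) _; apply: lerD.
    apply: le_trans (ltW xy); apply: (lp_norm_le p_gt0 (lp_norm_ge0 _ _)).
    rewrite (lp_sum_trunc _ _ p_gt0) -(lp_sum_powR p_gt0 xyp).
    exact: lp_sum_part.
  apply: lp_norm_trunc_le (ltW e0) _ => k kN.
  exact: (yz (Ordinal kN)).
have zp : z \in lp_pred p1.
  have [x Fx] := Fc _ ltr01; have := close _ _ ltr01 Fx => xz.
  have -> : z = lp_val x - (lp_val x - z) by rewrite opprB addrC subrK.
  rewrite rpredB ?lp_valP// inE; apply: le_lt_trans xz _; exact: ltry.
apply/cvg_ex; exists (Lp zp); apply/cvgrPdist_le => e.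
rewrite ltcE => /andP[/eqP/= eI eR].
have -> : e = (complex.Re e)%:C by case: e eI {eR} => a b /= ->.
move: (complex.Re e) eR => {eI} r r0; have r30 : 0 < r / 3 by rewrite divr_gt0.
have [x Fx] := Fc _ r30; have xz := close _ _ r30 Fx.
have xz' : lp_norm p (lp_val x - z) <= r / 3 + r / 3.
  by apply: lp_norm_le xz => //; rewrite addr_ge0// ltW.
apply: filterS Fx => y xy; apply: (@le_trans _ _ (`|Lp zp - x| + `|x - y|)).
  by rewrite -[Lp zp - y](subrKA x) ler_normD.
rewrite distrC !lp_normrE lecE /= addr0 eqxx/=.
have -> : r = (r / 3 + r / 3) + r / 3 by field.
exact: lerD xz' (ltW xy).
Unshelve. all: by end_near. Qed.
HB.instance Definition _ := Uniform_isComplete.Build (lp p1) lp_complete.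

End lp_complete.

Section continuous_spectrum.
Context {R : realType} {X : completeNormedModType R[i]}.

(* T - l I *)
Definition sub_scalar (T : {linear X -> X}) (l : R[i]) : X -> X :=
  fun x => T x - l *: x.

(* On [range f], [pinv setT f] is the inverse of the injective map [f]. *)
Definition bounded_inverse (f : X -> X) : Prop :=
  exists M : R, forall y : X, range f y -> `|pinv setT f y| <= M%:C * `|y|.

Definition continuous_spectrum (T : {linear X -> X}) : set R[i] :=
  [set l | [/\ injective (sub_scalar T l),
               dense (range (sub_scalar T l)) &
               ~ bounded_inverse (sub_scalar T l)]].

End continuous_spectrum.

(* U(s,r,s) *)
Section symtriband.
Context {R : realType} (p : R) (p1 : 1 <= p) (s r : R[i]).

Definition symtriband_seq (x : nat -> R[i]) : nat -> R[i] := fun k =>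
  s * (if k is j.+1 then x j else 0) + r * x k + s * x k.+1.

Lemma symtriband_seq_lp (x : lp p1) : symtriband_seq x \in lp_pred p1.
Proof.
have p0 : 0 < p by exact: lt_le_trans p1.
pose xr : nat -> R[i]^o := fun k => if k is j.+1 then x j else 0.
pose xl : nat -> R[i]^o := fun k => x k.+1.
have -> : symtriband_seq x = s *: xr + r *: lp_val x + s *: xl by [].
have xrp : xr \in lp_pred p1 by rewrite inE (lp_sum_shiftr x p0); exact: lp_sum_lty.
have xlp : xl \in lp_pred p1.
  by rewrite inE; apply: le_lt_trans (lp_sum_shiftl p x) (lp_sum_lty x).
by rewrite !rpredD ?rpredZ// lp_valP.
Qed.

Definition symtriband (x : lp p1) : lp p1 := Lp (symtriband_seq_lp x).

Lemma symtriband_is_linear : linear symtriband.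
Proof.
move=> a x y; apply/val_inj/funext => k.
case: k => [|k] /=; rewrite /symtriband_seq !fctE /= /GRing.scale/=; ring.
Qed.

HB.instance Definition _ :=
  GRing.isLinear.Build R[i] (lp p1) (lp p1) _ symtriband symtriband_is_linear.

Lemma symtriband_bounded (x : lp p1) :
  `|symtriband x| <= (`|s| + `|r| + `|s|) * `|x|.
Proof.
have p0 : 0 < p by exact: lt_le_trans p1.
pose xr : nat -> R[i]^o := fun k => if k is j.+1 then x j else 0.
pose xl : nat -> R[i]^o := fun k => x k.+1.
have xrp : xr \in lp_pred p1 by rewrite inE (lp_sum_shiftr x p0); exact: lp_sum_lty.
have xlp : xl \in lp_pred p1.
  by rewrite inE; apply: le_lt_trans (lp_sum_shiftl p x) (lp_sum_lty x).
have -> : symtriband x = s *: Lp xrp + r *: x + s *: Lp xlp by exact/val_inj.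
have nr : `|Lp xrp| <= `|x|.
  by rewrite !lp_normrE lecR /lp_norm /= (lp_sum_shiftr x p0).
have nl : `|Lp xlp| <= `|x|.
  rewrite !lp_normrE lecR; apply: lp_norm_le; rewrite ?lp_norm_ge0//.
  rewrite -(lp_sum_powR p0 (lp_sum_lty x)); exact: lp_sum_shiftl.
rewrite (le_trans (ler_normD _ _))// mulrDl; apply: lerD; last first.
  by rewrite normrZ; exact: ler_wpM2l (normr_ge0 s) _ _ nl.
rewrite (le_trans (ler_normD _ _))// mulrDl; apply: lerD.
  by rewrite normrZ; exact: ler_wpM2l (normr_ge0 s) _ _ nr.
by rewrite normrZ.
Qed.

Lemma symtriband_continuous : continuous symtriband.
Proof.
apply: bounded_linear_continuous; apply/linear_boundedP.
near=> M => x; apply: le_trans (symtriband_bounded x) _.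
by apply: ler_wpM2r => //; near: M; apply: nbhs_pinfty_ge; rewrite !realD.
Unshelve. all: by end_near. Qed.

End symtriband.
Arguments symtriband {R p} p1 s r x.

(* [r - 2s, r + 2s]; for complex [s] this is a segment of the complex plane. *)
Definition cos_segment {R : realType} (r s : R[i]) : set R[i] :=
  [set r + 2 * s * (cos t)%:C | t in `[0, 2 * pi]].

(* Main.v *)
(** Write the spectral parameter as [l = r + s (z + 1/z)] with [0 < |z| <= 1];
    then [l] lies in the segment iff [|z| = 1].  With [L] and [S] the left and
    right shifts, [L S = 1] gives [U - l = - (s/z) (1 - z L) (1 - z S)].
    - If [|z| < 1], both factors are bounded below, so the inverse is bounded.
    - If [|z| = 1], a kernel vector of [1 - z L] has constant modulus, hence is
      zero, and [1 - z S] is injective.  The vectors [sum_(k <= N) z^k e_k] have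
      norm [(N+1)^(1/p)] but bounded image, so the inverse is unbounded.  Since
      [e_0 = (1 - z L) e_0] and [e_0 - (1/N) sum_(k < N) z^k e_k] is in the range
      of [1 - z S], with an error of norm [N^(1/p-1) -> 0] because [p > 1], the
      closure of the range contains [e_0]; by the three-term recurrence it then
      contains every [e_n]. *)
Require Import Defs.
From HB Require Import structures.
From mathcomp Require Import all_boot all_order all_algebra.
From mathcomp Require Import complex.
From mathcomp Require Import all_classical all_reals all_analysis.
From mathcomp Require Import ring.
Import Order.TTheory GRing.Theory Num.Theory.
Import numFieldNormedType.Exports.

Local Open Scope classical_set_scope.
Local Open Scope complex_scope.
Local Open Scope ring_scope.

Import ComplexField.Normc.

Set Implicit Arguments.
Unset Strict Implicit.

(** * The segment as the image of the unit circle under z + 1/z *)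

Section complex_facts.
Context {R : realType}.
Implicit Types z : R[i].

Lemma normrE_normc z : `|z| = (normc z)%:C.
Proof. by rewrite normc_def; case: z. Qed.

Lemma normc_nat n : normc (n%:R : R[i]) = n%:R.
Proof.
by rewrite -(rmorph_nat (real_complex R)) /= expr0n addr0 sqrtr_sqr normr_nat.
Qed.

(** The roots of X^2 - mu X + 1 have sum [mu] and product 1, so they are mutually inverse and one of
    them has modulus at most 1. *)
Lemma exists_add_inv (mu : R[i]) :
  exists z, [/\ z != 0, `|z| <= 1 & z + z^-1 = mu].
Proof.
pose z := (mu + sqrtc (mu ^+ 2 - 4)) / 2.
pose w := (mu - sqrtc (mu ^+ 2 - 4)) / 2.
have two0 : (2 : R[i]) != 0 by rewrite pnatr_eq0.
have zw : z * w = 1.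
  rewrite /z /w mulf_div [X in X / _]mulrC -subr_sqr sqr_sqrtc.
  by rewrite -[RHS](divff (x := 2 * 2 : R[i])) ?mulf_neq0//; congr (_ / _); ring.
have zDw : z + w = mu by rewrite /z /w; field.
have z0 : z != 0 by apply: contra_eq_neq zw => ->; rewrite mul0r eq_sym oner_eq0.
have w0 : w != 0 by apply: contra_eq_neq zw => ->; rewrite mulr0 eq_sym oner_eq0.
have wV : w = z^-1 by apply: (mulfI z0); rewrite zw divff.
have zV : z = w^-1 by rewrite wV invrK.
have [z1|z1] := leP (normc z) 1.
  by exists z; rewrite z0 -wV zDw normrE_normc -[1]/(1%:C) lecR z1.
exists w; rewrite w0 -zV addrC zDw normrE_normc -[1]/(1%:C) lecR; split=> //.
by rewrite wV normcV invf_le1 ?ltW// (lt_trans _ z1).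
Qed.

(** On the unit circle 1/z is the conjugate of z, so z + 1/z = 2 Re z, which is 2 cos t for z =
    e^(it). *)
Lemma cos_segmentE (r s : R[i]) :
  cos_segment r s = [set r + s * (z + z^-1) | z in [set z | `|z| = 1]].
Proof.
have unitV (a b : R) : a ^+ 2 + b ^+ 2 = 1 -> (a +i* b)^-1 = a -i* b.
  by move=> ab; rewrite /GRing.inv/= ab !divr1.
apply/seteqP; split=> [l [t _ <-]|l [[a b] /= + <-]].
  have tt : cos t ^+ 2 + sin t ^+ 2 = 1 by rewrite cos2Dsin2.
  exists (cos t +i* sin t) => /=; first by rewrite normrE_normc/= tt sqrtr1.
  rewrite unitV//; apply: congr1; rewrite mulrAC mulrC; congr (_ * _).
  by apply/eqP; rewrite eq_complex /=; apply/andP; split; apply/eqP; ring.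
rewrite normrE_normc => /complexI /= /(congr1 (fun x => x ^+ 2)).
rewrite expr1n sqr_sqrtr ?addr_ge0 ?sqr_ge0// => ab1.
have aI : -1 <= a <= 1.
  rewrite -ler_norml -(@expr_le1 _ 2)// real_normK ?num_real//.
  by rewrite -ab1 lerDl sqr_ge0.
(* Only the real part [a] enters, so [acos a] in [0, pi] serves for either sign of [b]. *)
exists (acos a).
  rewrite /= in_itv/= acos_ge0//= (le_trans (acos_lepi aI))//.
  by rewrite ler_peMl ?pi_ge0// ler1n.
rewrite acosK ?in_itv// unitV//; apply: congr1; rewrite mulrAC mulrC; congr (_ * _).
by apply/eqP; rewrite eq_complex /=; apply/andP; split; apply/eqP; ring.
Qed.

End complex_facts.

(** * Decay of N^(1-p) for p > 1 *)

Section powR_archimedean.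
Context {R : realType}.

(** With N = n+1 the left side is N^(1-p), the p-th power of the norm of a vector with N entries of
    modulus 1/N. The witness is an Archimedean bound of e^(-1/(p-1)). *)
Lemma exists_nat_powR (p e : R) : 1 < p -> 0 < e ->
  exists n, n.+1%:R * (n.+1%:R^-1) `^ p <= e.
Proof.
move=> p1 e0; have q0 : 0 < p - 1 by rewrite subr_gt0.
have b0 : 0 <= e^-1 `^ (p - 1)^-1 by exact: powR_ge0.
have := archi_boundP b0; set n := Num.bound _ => bn; exists n.
have n0 : 0 < n.+1%:R :> R by rewrite ltr0Sn.
have -> : n.+1%:R * (n.+1%:R^-1) `^ p = (n.+1%:R `^ (p - 1))^-1 :> R.
  rewrite -(powR_inv1 (ltW n0)) -powRrM -{1}(powRr1 (ltW n0)) -powRD; last first.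
    by rewrite (gt_eqF n0) implybT.
  by rewrite -powRN; congr (_ `^ _); ring.
rewrite invf_ple ?posrE ?powR_gt0//.
have -> : e^-1 = (e^-1 `^ (p - 1)^-1) `^ (p - 1).
  by rewrite -powRrM mulVf ?gt_eqF// powRr1 ?invr_ge0 ?ltW.
by rewrite ge0_ler_powR ?nnegrE ?(ltW q0)// (le_trans (ltW bn))// ler_nat.
Qed.

End powR_archimedean.

(** * Bounded inverses and lower norm bounds *)

Section bounded_inverse.
Context {R : realType} {X : completeNormedModType R[i]}.

Lemma bounded_below_bounded_inverse (f : X -> X) (c : R) : 0 < c ->
  (forall x, c%:C * `|x| <= `|f x|) -> bounded_inverse f.
Proof.
move=> c0 fc; exists c^-1 => y fy.
have {2}<- : f (pinv setT f y) = y by apply: pinvK; rewrite inE.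
have c0C : 0 < c%:C :> R[i] by rewrite ltcR.
rewrite -(ler_pM2l c0C) mulrA -rmorphM divff ?gt_eqF// mul1r; exact: fc.
Qed.

Lemma bounded_inverse_bounded_below (f : X -> X) : injective f ->
  bounded_inverse f -> exists M : R, forall x, `|x| <= M%:C * `|f x|.
Proof.
move=> fI [M fM]; exists M => x.
have fK : pinv setT f (f x) = x.
  by apply: pinvKV; rewrite ?inE// => ? ? _ _; exact: fI.
by rewrite -{1}fK; apply: fM; exists x.
Qed.

End bounded_inverse.

(** * Shifts, truncations and unit vectors *)

Section lp_shift.
Context {R : realType} {p : R} {p1 : 1 <= p}.
Implicit Types x y : lp p1.

Let p0 : 0 < p. Proof. exact: lt_le_trans p1. Qed.

Lemma lp_shiftr_subproof x :
  (fun k => if k is j.+1 then x j else 0 : R[i]^o) \in lp_pred p1.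
Proof. by rewrite inE (lp_sum_shiftr x p0); exact: lp_sum_lty. Qed.

Definition lp_shiftr x : lp p1 := Lp (lp_shiftr_subproof x).

Lemma lp_shiftl_subproof x : (fun k => x k.+1) \in lp_pred p1.
Proof. by rewrite inE; exact: le_lt_trans (lp_sum_shiftl p x) (lp_sum_lty x). Qed.

Definition lp_shiftl x : lp p1 := Lp (lp_shiftl_subproof x).

Lemma norm_lp_shiftr x : `|lp_shiftr x| = `|x|.
Proof. by rewrite !lp_normrE /lp_norm /= (lp_sum_shiftr x p0). Qed.

Lemma norm_lp_shiftl x : `|lp_shiftl x| <= `|x|.
Proof.
rewrite !lp_normrE lecR; apply: lp_norm_le; rewrite ?lp_norm_ge0//.
rewrite -(lp_sum_powR p0 (lp_sum_lty x)); exact: lp_sum_shiftl.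
Qed.

Lemma lp_trunc_subproof N (x : nat -> R[i]^o) : lp_trunc N x \in lp_pred p1.
Proof. by rewrite inE lp_sum_trunc// ltry. Qed.

Definition lp_cut N (x : nat -> R[i]^o) : lp p1 := Lp (lp_trunc_subproof N x).

(** The unit vector e_n; written as a truncation, it lies in the space at once. *)
Definition lp_delta (n : nat) : lp p1 :=
  lp_cut n.+1 (fun k => (k == n)%:R).

Lemma lp_deltaE n k : lp_delta n k = (k == n)%:R.
Proof.
rewrite /= /lp_trunc; case: ifPn => //; rewrite -leqNgt => nk.
by rewrite gtn_eqF.
Qed.

Lemma lp_cutS N (x : nat -> R[i]^o) :
  lp_cut N.+1 x = lp_cut N x + x N *: lp_delta N.
Proof.
apply/val_inj/funext => k.
change (lp_trunc N.+1 x k = lp_trunc N x k + x N *: lp_delta N k).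
rewrite lp_deltaE /lp_trunc ltnS leq_eqVlt.
have [->|kN] /= := eqVneq k N; first by rewrite ltnn add0r /GRing.scale/= mulr1.
by rewrite /GRing.scale/= mulr0 addr0.
Qed.

Lemma lp_cut0 (x : nat -> R[i]^o) : lp_cut 0 x = 0.
Proof. exact/val_inj/funext. Qed.

Lemma norm_lp_delta n : `|lp_delta n| = 1.
Proof.
rewrite lp_normrE /lp_norm lp_sum_trunc// (bigD1 ord_max)//= eqxx normc1 powR1.
rewrite big1 ?addr0 ?powR1// => i; rewrite -val_eqE => /negPf /= ->.
by rewrite normc0 powR0 ?gt_eqF.
Qed.

(** The p-th power of the error is a tail of a convergent series. *)
Lemma lp_cut_cvg x (e : R) : 0 < e -> exists N, `|x - lp_cut N x| <= e%:C.
Proof.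
move=> e0; have f0 k : (0 <= (normc (x k) `^ p)%:E)%E by rewrite lee_fin powR_ge0.
have ep0 : 0 < e `^ p by exact: powR_gt0.
have := nneseries_tail_cvg (lp_sum_lty x) (fun k _ => f0 k).
move=> /fine_cvgP[tf /cvgrPdist_le /(_ _ ep0)] H.
have [N [/= fN]] := filter_ex (filterI tf H).
rewrite sub0r normrN ger0_norm ?fine_ge0 ?nneseries_ge0// => eN.
exists N; rewrite lp_normrE lecR; apply: lp_norm_le => //; first exact: ltW.
rewrite /lp_sum (nneseries_split 0 N); last by move=> k _; rewrite lee_fin powR_ge0.
rewrite [X in (X + _)%E]big_nat_cond [X in (X + _)%E]big1 ?add0e; last first.
  move=> k /andP[/andP[_ kN] _]; rewrite add0n in kN.
  change ((normc (x k - lp_trunc N x k) `^ p)%:E = 0).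
  by rewrite /lp_trunc kN subrr normc0 powR0 ?gt_eqF.
rewrite add0n -lee_fin (fineK fN) in eN *; apply: le_trans eN.
apply: lee_nneseries => [k _ _|k _]; first by rewrite lee_fin powR_ge0.
change ((normc (x k - lp_trunc N x k) `^ p)%:E <= (normc (x k) `^ p)%:E)%E.
rewrite /lp_trunc; case: ifP => _; last by rewrite subr0.
by rewrite subrr normc0 powR0 ?gt_eqF.
Qed.

End lp_shift.
Arguments lp_delta {R p} p1 n.

(** * Norm bounds for factors of the form 1 - a S *)

Section norm_subZ.
Context {K : numFieldType} {V : normedModType K}.
Implicit Types (a : K) (v w : V).

(** Reverse triangle inequality. With [w] a shift of [v], it bounds 1 - z L and 1 - z S below by 1 -
    |z|. *)
Lemma ler_norm_subZ a v w : `|w| <= `|v| ->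
  (1 - `|a|) * `|v| <= `|v - a *: w|.
Proof.
move=> wv; apply: le_trans (lerB_normD _ _).
rewrite normrN normrZ mulrBl mul1r lerB//.
by rewrite ler_wpM2l.
Qed.

Lemma norm_subZ_le a v w : `|a| <= 1 -> `|w| <= `|v| ->
  `|v - a *: w| <= 2 * `|v|.
Proof.
move=> a1 wv; rewrite (le_trans (ler_normB _ _))// normrZ mulr_natl mulr2n.
rewrite lerD2l; apply: le_trans wv; exact: ler_piMl.
Qed.

End norm_subZ.

(** * Linearity of T - l I *)

Section sub_scalar_linear.
Context {R : realType} {X : completeNormedModType R[i]}.
Variables (T : {linear X -> X}) (l : R[i]).

Lemma sub_scalar_is_linear : linear (sub_scalar T l).
Proof.
move=> a x y; rewrite /sub_scalar linearP scalerDr scalerBr !scalerA mulrC.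
by rewrite opprD addrACA.
Qed.

HB.instance Definition _ :=
  GRing.isLinear.Build R[i] X X _ (sub_scalar T l) sub_scalar_is_linear.

End sub_scalar_linear.

(** * The closure of the range of a linear map *)

Section dense_range.
Context {R : realType} {X : completeNormedModType R[i]}.

(** Membership of [y] in the closure of the range, with real tolerances. *)
Definition near_range (f : X -> X) (y : X) : Prop :=
  forall e : R, 0 < e -> exists x, `|f x - y| <= e%:C.

Variable f : {linear X -> X}.

Lemma near_range0 : near_range f 0.
Proof. by move=> e e0; exists 0; rewrite linear0 subr0 normr0 ler0c ltW. Qed.

Lemma near_range_im x : near_range f (f x).
Proof. by move=> e e0; exists x; rewrite subrr normr0 ler0c ltW. Qed.

Lemma near_rangeD y z : near_range f y -> near_range f z -> near_range f (y + z).
Proof.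
move=> fy fz e e0; have e20 : 0 < e / 2 by rewrite divr_gt0.
have [[x xy] [x' xz]] := (fy _ e20, fz _ e20); exists (x + x').
rewrite linearD opprD addrACA (le_trans (ler_normD _ _))//.
by rewrite [e]splitr rmorphD lerD.
Qed.

Lemma near_rangeZ (a : R[i]) y : near_range f y -> near_range f (a *: y).
Proof.
move=> fy e e0; have a0 : 0 < normc a + 1 by rewrite ltr_wpDl ?normc_ge0.
have [x xy] := fy _ (divr_gt0 e0 a0); exists (a *: x).
rewrite linearZ -scalerBr normrZ normrE_normc.
apply: (@le_trans _ _ ((normc a + 1)%:C * (e / (normc a + 1))%:C)); last first.
  by rewrite -rmorphM lecR mulrC divfK ?gt_eqF.
by apply: ler_pM; rewrite ?ler0c ?normc_ge0// lecR lerDl.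
Qed.

Lemma near_rangeB y z : near_range f y -> near_range f z -> near_range f (y - z).
Proof. by move=> fy fz; rewrite -scaleN1r; apply/near_rangeD/near_rangeZ. Qed.

(** Vectors in the closure of the range form a subspace, so each relation can be solved for its term
    of highest index. *)
Lemma near_range_recurrence (s a : R[i]) (d : nat -> X) : s != 0 ->
  near_range f (d 0%N) ->
  f (d 0%N) = s *: d 1%N - a *: d 0%N ->
  (forall n, f (d n.+1) = s *: d n - a *: d n.+1 + s *: d n.+2) ->
  forall n, near_range f (d n).
Proof.
move=> s0 d0 fd0 fdS.
have unscale y : near_range f (s *: y) -> near_range f y.
  by move=> /(near_rangeZ s^-1); rewrite scalerA mulVf// scale1r.
(* The recurrence involves the two preceding terms, so the induction carries a pair. *)
suff H n : near_range f (d n) /\ near_range f (d n.+1) by move=> n; have [] := H n.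
elim: n => [|n [IH IHS]]; split=> //; apply: unscale.
  rewrite -[s *: _](subrK (a *: d 0%N)) -fd0.
  by apply/near_rangeD/near_rangeZ; first exact: near_range_im.
rewrite -[s *: _](addKr (s *: d n - a *: d n.+1)) -fdS addrC.
apply/near_rangeB/near_rangeB; [exact: near_range_im|exact: near_rangeZ..].
Qed.

Lemma near_range_closed y :
  (forall e : R, 0 < e -> exists2 z, near_range f z & `|y - z| <= e%:C) ->
  near_range f y.
Proof.
move=> yz e e0; have e20 : 0 < e / 2 by rewrite divr_gt0.
have [z fz yze] := yz _ e20; have [x xz] := fz _ e20; exists x.
rewrite -(subrKA z) (le_trans (ler_normD _ _))//.
by rewrite [e]splitr rmorphD lerD// distrC.
Qed.

Lemma near_range_dense : (forall y, near_range f y) -> dense (range f).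
Proof.
move=> fr O [y Oy] Oo; have /nbhs_ballP[e /= e0 eO] := open_nbhs_nbhs (conj Oo Oy).
(* Balls have radii in [R[i]]; a positive radius is real. *)
have eE : e = (complex.Re e)%:C by rewrite RRe_real// gtr0_real.
have re0 : 0 < complex.Re e by rewrite -ltcR -eE.
have re20 : 0 < complex.Re e / 2 by rewrite divr_gt0.
have [x xy] := fr y _ re20.
exists (f x); split; last by exists x.
apply: eO; rewrite -ball_normE /ball_ /= distrC (le_lt_trans xy)// eE ltcR.
by rewrite ltr_pdivrMr// ltr_pMr// ltr1n.
Qed.

End dense_range.

(** * The operator U - l for l = r + s (z + 1/z) *)

Section symtriband_spectrum.
Context {R : realType} {p : R} (p1 : 1 <= p) (r s z : R[i]).
Hypothesis z0 : z != 0.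
Implicit Types x : lp p1.

Let p0 : 0 < p. Proof. exact: lt_le_trans p1. Qed.

Local Notation f := (sub_scalar (symtriband p1 s r) (r + s * (z + z^-1))).

Lemma sub_scalar_symtribandE x :
  let w := x - z *: lp_shiftr x in f x = - (s / z) *: (w - z *: lp_shiftl w).
Proof.
apply/val_inj/funext => k.
(* The identity L S = 1 is hidden in the last entry: (L w)_k = w_(k+1) = x_(k+1) - z x_k. *)
change (symtriband_seq s r x k - (r + s * (z + z^-1)) * x k =
  - (s / z) * ((x k - z * lp_shiftr x k) - z * (x k.+1 - z * x k))).
by case: k => [|k]; rewrite /symtriband_seq/=; field.
Qed.

(** Each of the two factors contributes one 1 - |z|. *)
Lemma sub_scalar_symtriband_ge x : `|z| <= 1 ->
  `|s / z| * (1 - `|z|) ^+ 2 * `|x| <= `|f x|.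
Proof.
move=> z1; have zN : 0 <= 1 - `|z| by rewrite subr_ge0.
rewrite sub_scalar_symtribandE /=; set w := x - _.
rewrite normrZ normrN -mulrA; apply: ler_wpM2l; first exact: normr_ge0.
apply: le_trans (ler_norm_subZ z (norm_lp_shiftl w)).
rewrite expr2 -mulrA; apply: ler_wpM2l; first exact: zN.
by apply: ler_norm_subZ; rewrite norm_lp_shiftr.
Qed.

Lemma sub_scalar_symtriband_le x : `|z| <= 1 ->
  `|f x| <= `|s / z| * (2 * `|x - z *: lp_shiftr x|).
Proof.
move=> z1; rewrite sub_scalar_symtribandE /=; set w := x - _.
rewrite normrZ normrN; apply: ler_wpM2l; first exact: normr_ge0.
exact: norm_subZ_le z1 (norm_lp_shiftl w).
Qed.

(** If c is the common modulus, the partial sums N c^p are bounded by a finite number for all N,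
    which forces c = 0. *)
Lemma lp_norm_cst_eq0 x : (forall k, normc (x k) = normc (x 0%N)) -> x = 0.
Proof.
move=> xc; have S0 : 0 <= fine (lp_sum p x) by rewrite fine_ge0// lp_sum_ge0.
suff x00 : normc (x 0%N) = 0.
  by apply/val_inj/funext => k; apply: eq0_normc; rewrite xc.
apply/eqP; rewrite -[_ == _]negbK; apply/negP => x00.
have cp : 0 < normc (x 0%N) `^ p by rewrite powR_gt0// lt_def x00 normc_ge0.
have := archi_boundP (divr_ge0 S0 (ltW cp)); set N := Num.bound _.
apply/negP; rewrite -leNgt ler_pdivlMr// -lee_fin fineK; last first.
  by rewrite ge0_fin_numE ?lp_sum_lty// lp_sum_ge0.
apply: le_trans (lp_sum_part p N x); rewrite lee_fin.
under eq_bigr do rewrite xc.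
by rewrite sumr_const card_ord mulr_natl.
Qed.

(** * The case |z| = 1: injectivity, unbounded inverse, dense range *)

Hypothesis s0 : s != 0.
Hypothesis z1 : `|z| = 1.

Let z1_le1 : `|z| <= 1. Proof. by rewrite z1. Qed.

Let normcz : normc z = 1.
Proof. by move: z1; rewrite normrE_normc => /complexI. Qed.

Let normcX k : normc (z ^+ k) = 1.
Proof. by elim: k => [|k IH]; rewrite ?expr0 ?normc1// exprS normcM IH mulr1. Qed.

Lemma sub_scalar_symtriband_inj : injective f.
Proof.
suff f0 x : f x = 0 -> x = 0.
  move=> x y fxy; apply/eqP; rewrite -subr_eq0; apply/eqP/f0.
  have -> : f (x - y) = f x - f y by exact: linearB.
  by rewrite fxy subrr.
rewrite sub_scalar_symtribandE /=.
have sz0 : - (s / z) != 0 by rewrite oppr_eq0 mulf_neq0// invr_eq0.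
move=> /eqP; rewrite scaler_eq0 (negPf sz0)/= => /eqP.
set w := x - _ => lw.
have w_eq k : w k = z * w k.+1.
  apply/eqP; rewrite -subr_eq0; apply/eqP.
  by change ((w - z *: lp_shiftl w : lp p1) k = 0); rewrite lw.
(* Since |z| = 1, the relation w_k = z w_(k+1) makes |w_k| constant. *)
have w0 : w = 0.
  apply: lp_norm_cst_eq0; elim=> // k <-.
  by rewrite (w_eq k) normcM normcz mul1r.
have x_eq k : x k = z * lp_shiftr x k.
  apply/eqP; rewrite -subr_eq0; apply/eqP.
  by change (w k = 0); rewrite w0.
suff xk k : x k = 0 by apply/val_inj/funext => k; exact: xk.
(* The right shift vanishes at index 0, so x_0 = 0, and x_(k+1) = z x_k propagates this. *)
by elim: k => [|k IH]; rewrite x_eq/= ?mulr0// IH mulr0.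
Qed.

Lemma sub_scalar_symtriband_unbounded : ~ bounded_inverse f.
Proof.
move=> /(bounded_inverse_bounded_below sub_scalar_symtriband_inj)[M fM].
(* One 2 bounds 1 - z L; the other bounds the difference of two unit vectors. *)
pose K := `|M| * (normc (s / z) * (2 * 2)).
have Kp : 0 <= K `^ p by exact: powR_ge0.
(* [N] exceeds K^p, while the vector below has p-th power norm N + 1 and norm at most [K]. *)
have := archi_boundP Kp; move: (Num.bound _) => N; apply/negP; rewrite -leNgt.
pose x : lp p1 := lp_cut N.+1 (fun k => z ^+ k).
(* The product telescopes and leaves only the two ends. *)
have wE : x - z *: lp_shiftr x = lp_delta p1 0 - z ^+ N.+1 *: lp_delta p1 N.+1.
  apply/val_inj/funext => k.
  change (x k - z * lp_shiftr x k =
    lp_delta p1 0 k - z ^+ N.+1 * lp_delta p1 N.+1 k).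
  rewrite !lp_deltaE; case: k => [|k] /=; first by rewrite /lp_trunc/= expr0 !mulr0.
  rewrite /lp_trunc /= eqSS !ltnS exprS.
  by case: (ltngtP k N) => kN;
    rewrite ?mulr0 ?subrr// ?subr0 ?kN ?mulr1 -?exprS ?sub0r ?mulr0 ?subrr//.
have fxK : lp_norm p (f x) <= normc (s / z) * (2 * 2).
  rewrite -lecR -lp_normrE.
  apply: le_trans (sub_scalar_symtriband_le x z1_le1) _.
  rewrite normrE_normc rmorphM; apply: ler_wpM2l; first by rewrite ler0c normc_ge0.
  rewrite rmorphM rmorph_nat; apply: ler_wpM2l => //.
  rewrite wE; apply: le_trans (ler_normB _ _) _.
  by rewrite normrZ !norm_lp_delta normrE_normc normcX mulr1.
have xK : lp_norm p x <= K.
  have := fM x; rewrite !lp_normrE -rmorphM lecR => /le_trans; apply.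
  apply: le_trans (ler_wpM2r (lp_norm_ge0 _ _) (ler_norm M)) _.
  exact: ler_wpM2l.
have := lp_sum_le p0 (lp_sum_lty x) xK.
rewrite lp_sum_trunc// lee_fin; apply: le_trans.
under eq_bigr do rewrite normcX powR1.
by rewrite sumr_const card_ord ler_nat.
Qed.

Lemma near_range_delta0 : 1 < p -> near_range f (lp_delta p1 0).
Proof.
move=> p_gt1 e e0; have e20 : 0 < e / 2 by rewrite divr_gt0.
have [n ne] := exists_nat_powR p_gt1 (powR_gt0 p e20).
(* The weights drop by 1/(n+1) at each index and reach 0 at k = n, so (1 - z S) x = e_0 - g without
   a boundary term at n+1. *)
pose x : lp p1 := lp_cut n.+1 (fun k => (n - k)%:R / n.+1%:R * z ^+ k).
pose g : lp p1 := lp_cut n.+1 (fun k => z ^+ k / n.+1%:R).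
have wE : x - z *: lp_shiftr x = lp_delta p1 0 - g.
  apply/val_inj/funext => k.
  change (x k - z * lp_shiftr x k = lp_delta p1 0 k - g k).
  rewrite lp_deltaE /= /lp_trunc; case: k => [|k] /=.
    rewrite subn0 expr0 mulr0 subr0 mulr1 div1r -natr1; field.
    by rewrite natr1 pnatr_eq0.
  rewrite !ltnS; case: (ltngtP k n) => kn.
  - rewrite !natrB ?(ltnW kn)// -[k.+1%:R]natr1 exprS; field.
    by rewrite addrC natr1 pnatr_eq0.
  - by rewrite mulr0 subrr.
  - by rewrite kn subnn !mul0r mulr0 subrr.
have gE : `|g| <= (e / 2)%:C.
  rewrite lp_normrE lecR; apply: lp_norm_le => //; first exact: ltW.
  rewrite lp_sum_trunc// lee_fin; apply: le_trans ne.
  under eq_bigr do rewrite normcM normcX mul1r normcV normc_nat.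
  by rewrite sumr_const card_ord mulr_natl.
(* The scalar cancels the prefactor -(s/z). As L e_0 = 0, the image is e_0 - g + z L g, with error
   at most 2 |g| <= e. *)
exists (- (z / s) *: x); rewrite linearZ /= sub_scalar_symtribandE /= wE.
have -> : lp_shiftl (lp_delta p1 0 - g) = - lp_shiftl g.
  apply/val_inj/funext => k.
  change (lp_delta p1 0 k.+1 - g k.+1 = - g k.+1).
  by rewrite lp_deltaE sub0r.
rewrite scalerA mulrNN mulf_div [z * s]mulrC divff ?mulf_neq0// scale1r.
rewrite scalerN opprK addrAC [_ - g - _]addrAC subrr add0r.
apply: le_trans (ler_normD _ _) _.
rewrite normrN [e]splitr rmorphD; apply: lerD; first exact: gE.
rewrite normrZ z1 mul1r; exact: le_trans (norm_lp_shiftl g) gE.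
Qed.

(** The columns of the matrix U - l give the recurrence for the e_n, with a = l - r. *)
Lemma near_range_delta n : 1 < p -> near_range f (lp_delta p1 n).
Proof.
move=> p_gt1; have H0 := near_range_delta0 p_gt1.
apply: (near_range_recurrence (a := s * (z + z^-1)) s0 H0).
  apply/val_inj/funext => k.
  change (symtriband_seq s r (lp_delta p1 0) k
      - (r + s * (z + z^-1)) * lp_delta p1 0 k =
    s * lp_delta p1 1 k - s * (z + z^-1) * lp_delta p1 0 k).
  by rewrite /symtriband_seq; case: k => [|k]; rewrite !lp_deltaE ?eqSS /=; ring.
move=> m; apply/val_inj/funext => k.
change (symtriband_seq s r (lp_delta p1 m.+1) k
    - (r + s * (z + z^-1)) * lp_delta p1 m.+1 k =
  s * lp_delta p1 m k - s * (z + z^-1) * lp_delta p1 m.+1 k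
    + s * lp_delta p1 m.+2 k).
by rewrite /symtriband_seq; case: k => [|k]; rewrite !lp_deltaE ?eqSS /=; ring.
Qed.

Lemma sub_scalar_symtriband_dense : 1 < p -> dense (range f).
Proof.
move=> p_gt1; apply: near_range_dense => y; apply: near_range_closed => e e0.
(* A truncation is a finite combination of the e_n. *)
have [N yN] := lp_cut_cvg y e0; exists (lp_cut N y); last exact: yN.
elim: N {yN} => [|N IH]; first by rewrite lp_cut0; exact: near_range0.
by rewrite lp_cutS; exact: near_rangeD IH (near_rangeZ _ (near_range_delta N p_gt1)).
Qed.

End symtriband_spectrum.

(** For s = 0 the segment is {r}, but U - r I = 0 is not injective and the continuous spectrum is
    empty; hence the hypothesis [s_neq0]. *)
Theorem theorem3p6 (R : realType) (p : R) (p_gt1 : 1 < p) (r s : R[i])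
    (s_neq0 : s != 0) :
  continuous_spectrum (symtriband (ltW p_gt1) s r) = cos_segment r s.
Proof.
rewrite cos_segmentE; apply/seteqP; split=> [l [_ _ unb]|_ [z /= z1 <-]].
  have [z [z0 z1 zE]] := exists_add_inv ((l - r) / s).
  have lE : r + s * (z + z^-1) = l.
    by rewrite zE mulrC divfK// addrC subrK.
  (* Otherwise |z| < 1, and the lower bound on U - l gives a bounded inverse. *)
  exists z => //=; apply: contrapT => /eqP z_neq1; apply: unb.
  have zlt1 : normc z < 1.
    by rewrite -ltcR -normrE_normc lt_neqAle z_neq1.
  have sz : 0 < normc (s / z).
    by rewrite lt_def normc_ge0 andbT; apply: contra_neq s_neq0 => /eq0_normc
      /eqP; rewrite mulf_eq0 invr_eq0 (negPf z0) orbF => /eqP.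
  apply: (@bounded_below_bounded_inverse _ _ _ (normc (s / z) * (1 - normc z) ^+ 2)).
    by rewrite mulr_gt0// exprn_gt0// subr_gt0.
  have -> : (normc (s / z) * (1 - normc z) ^+ 2)%:C =
      `|s / z| * (1 - `|z|) ^+ 2.
    by rewrite !normrE_normc rmorphM rmorphXn rmorphB.
  by move=> x; rewrite -lE; exact: sub_scalar_symtriband_ge.
have z0 : z != 0 by rewrite -normr_eq0 z1 oner_eq0.
split.
- exact: sub_scalar_symtriband_inj.
- exact: sub_scalar_symtriband_dense.
- exact: sub_scalar_symtriband_unbounded.
Qed.
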